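(* If $G$ is a graph with maximum degree at most $3$ and $\mathrm{mad}(G)<\frac{14}{5}$, then $\chi_l(G^2)\le 7$.
   Context: All graphs are finite and simple. $\mathrm{mad}(G)$, the maximum average degree of $G$, is the maximum of $2|E(H)|/|V(H)|$ over all induced subgraphs $H$ of $G$. The square $G^2$ of $G$ has vertex set $V(G)$, with two vertices adjacent if their distance in $G$ is at most $2$. $\chi_l$ denotes the list chromatic number. *)

(* Defs.v *)
From mathcomp Require Import all_boot all_order all_algebra.
From mathcomp Require Import boolp.

Set Implicit Arguments.
Unset Strict Implicit.
Unset Printing Implicit Defensive.

Record sgraph := SGraph {
  vertex :> finType;
  adj : rel vertex;
  adj_sym : symmetric adj;
  adj_irrefl : irreflexive adj
}.

Section Graph.
Variable G : sgraph.

Definition edges : {set {set G}} :=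
  [set [set p.1; p.2] | p : G * G & adj p.1 p.2].

Definition degree (x : G) : nat := #|[set y | adj x y]|.

Definition max_degree : nat := \max_(x : G) degree x.

Definition walk (n : nat) (x y : G) : bool :=
  [exists p : n.-tuple G, path (@adj G) x p && (last x p == y)].

(* Meaningful only for connected x and y: a shortest walk then has length
   < #|G|; on disconnected pairs the value is the junk #|G|. *)
Definition dist (x y : G) : nat :=
  find (fun n => walk n x y) (iota 0 #|G|).

Definition square_adj (x y : G) : bool :=
  [&& x != y, connect (@adj G) x y & dist x y <= 2].

Lemma walk_sym n (x y : G) : walk n x y = walk n y x.
Proof.
suff imp a b : walk n a b -> walk n b a by apply/idP/idP; apply: imp.
case/existsP=> p /andP[pth /eqP <-].
have sz : size (rev (belast a p)) == n by rewrite size_rev size_belast size_tuple.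
apply/existsP; exists (Tuple sz); apply/andP; split => /=.
  by rewrite rev_path (eq_path (e' := @adj G)) // => u v; rewrite adj_sym.
by case: (val p) => //= c q; rewrite rev_cons last_rcons.
Qed.

Lemma square_adj_sym : symmetric square_adj.
Proof.
move=> x y; rewrite /square_adj eq_sym (sym_connect_sym (@adj_sym G)).
by rewrite /dist (eq_find (fun n => walk_sym n x y)).
Qed.

Lemma square_adj_irrefl : irreflexive square_adj.
Proof. by move=> x; rewrite /square_adj eqxx. Qed.

Definition square : sgraph := SGraph square_adj_sym square_adj_irrefl.

Section Induced.
Variable S : {set G}.

Definition induced_adj : rel {x : G | x \in S} :=
  fun x y => adj (val x) (val y).

Lemma induced_adj_sym : symmetric induced_adj.
Proof. by move=> x y; apply: adj_sym. Qed.

Lemma induced_adj_irrefl : irreflexive induced_adj.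
Proof. by move=> x; apply: adj_irrefl. Qed.

Definition induced : sgraph := SGraph induced_adj_sym induced_adj_irrefl.
End Induced.

Definition proper_coloring (C : eqType) (c : G -> C) : Prop :=
  forall x y, adj x y -> c x != c y.

(* The list of a vertex is the set of colours of a duplicate-free sequence. *)
Definition choosable (k : nat) : Prop :=
  forall (C : eqType) (L : G -> seq C),
    (forall x, uniq (L x) /\ k <= size (L x)) ->
    exists2 c : G -> C, (forall x, c x \in L x) & proper_coloring c.

Lemma choosable_card : choosable #|G|.
Proof.
move=> C L HL.
suff [c cL c_inj] : exists2 c : G -> C,
    (forall x, c x \in L x) & {in enum G &, injective c}.
  exists c => // x y xy; apply/negP => /eqP eq_c.
  have xy_eq : x = y by apply: c_inj; rewrite ?mem_enum.
  by move: xy; rewrite xy_eq adj_irrefl.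
have : size (enum G) <= #|G| by rewrite cardE.
elim: (enum G) => [_|x s IHs /= sG].
  have pick_col v : {a | a \in L v}.
    case E: (L v) => [|a l]; last by exists a; rewrite mem_head.
    have := (HL v).2; rewrite E leqn0 => /eqP/card0_eq /(_ v).
    by rewrite inE.
  by exists (fun v => sval (pick_col v)) => // v; case: (pick_col v).
have [c cL c_inj] := IHs (ltnW sG).
have /hasP[a aL aNs] : has (fun a => a \notin map c s) (L x).
  have [uL szL] := HL x; rewrite -[has _ _]negbK -all_predC; apply/negP => /allP sub.
  have := leq_trans sG szL; rewrite ltnNge -(size_map c) uniq_leq_size //.
  by move=> b /sub /=; rewrite negbK.
exists (fun v => if v == x then a else c v) => [v|u v].
  by case: eqP => // ->.
rewrite !inE; case: (eqVneq u x) => [->|_]; case: (eqVneq v x) => [->|_] //= us vs.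
- by move=> ac; rewrite ac map_f in aNs.
- by move=> ca; rewrite -ca map_f in aNs.
- exact: c_inj.
Qed.

Lemma ex_choosable : exists k, `[< choosable k >].
Proof. by exists #|G|; apply/asboolP/choosable_card. Qed.

Definition list_chromatic_number : nat := ex_minn ex_choosable.

End Graph.

Definition average_degree (G : sgraph) : rat :=
  ((2 * #|edges G|)%:R / #|G|%:R)%R.

(* The base value 0 is harmless since average degrees are nonnegative; it only
   fixes the value 0 for the graph with no vertices. *)
Definition mad (G : sgraph) : rat :=
  \big[Num.max/0%R]_(S : {set G} | S != set0) average_degree (induced S).

(* Main.v *)
(** Take a vertex set A minimal such that the square of G[A] has no colouring
    from the lists, and call a vertex of degree at most 2 in G[A] small.  Colour
    the square of G[A - v] for a small v, erase the colours around v and recolour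
    greedily: a vertex with d neighbours in the square can be coloured as soon as
    d - 6 of them come later.  It follows that every small vertex has degree
    exactly 2, that no two of them are at distance at most 3, and that every
    other vertex has a neighbour without small neighbours.  Let every small
    vertex send weight 2 to each neighbour and weight 1 along each walk of
    length 2, including the two walks returning to itself: it sends 10 in total
    while no vertex receives more than 2.  So at most |A|/5 vertices are small
    and the average degree of G[A] is at least 14/5. *)
Require Import Defs.
From mathcomp Require Import all_boot all_order all_algebra.
From mathcomp Require Import zify boolp.

Set Implicit Arguments.
Unset Strict Implicit.
Unset Printing Implicit Defensive.

(** * Neighbourhoods in an induced subgraph and in its square *)

Section Neighbourhoods.
Variables (G : sgraph) (A : {set G}).
Implicit Types u v w x y z : G.

Definition nbr x : {set G} := [set y in A | adj x y].

(** For [x] in [A], the neighbourhood of [x] in the square of the graph induced on [A]; paths of [G]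
    leaving [A] do not count. *)
Definition nbr2 x : {set G} := (nbr x :|: \bigcup_(y in nbr x) nbr y) :\ x.

Lemma nbr_sym x y : x \in A -> y \in nbr x -> x \in nbr y.
Proof. by rewrite !inE adj_sym => -> /andP[]. Qed.

Lemma nbr_in x y : y \in nbr x -> y \in A.
Proof. by rewrite inE => /andP[]. Qed.

Lemma nbr_neq x y : y \in nbr x -> y != x.
Proof. by rewrite inE => /andP[_]; case: eqP => // ->; rewrite adj_irrefl. Qed.

Lemma nbr2_nbr x y : y \in nbr x -> y \in nbr2 x.
Proof. by move=> xy; rewrite in_setD1 in_setU (nbr_neq xy) xy. Qed.

Lemma nbr2_path x y z : y \in nbr x -> z \in nbr y -> z != x -> z \in nbr2 x.
Proof.
move=> xy yz zx; rewrite in_setD1 zx in_setU; apply/orP; right.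
by apply/bigcupP; exists y.
Qed.

Lemma nbr2P x y :
  y \in nbr2 x -> y != x /\ (y \in nbr x \/ exists2 z, z \in nbr x & y \in nbr z).
Proof.
rewrite in_setD1 in_setU => /andP[-> /orP[]]; first by split; [|left].
by case/bigcupP=> z xz zy; split=> //; right; exists z.
Qed.

Lemma nbr2_sym x y : x \in A -> y \in nbr2 x -> x \in nbr2 y.
Proof.
move=> xA /nbr2P[yx [xy|[z xz zy]]]; first exact/nbr2_nbr/nbr_sym.
by apply: (nbr2_path (y := z)); rewrite 1?eq_sym //; apply: nbr_sym => //; apply: nbr_in xz.
Qed.

(** What [x] can reach through its neighbour [y]. It trades [x] for [y] in [nbr y], so its size is
    at most the degree of [y], and degree sums bound the degree in the square. *)
Definition branch x y : {set G} := y |: nbr y :\ x.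

Lemma card_branch x y : x \in A -> y \in nbr x -> #|branch x y| <= #|nbr y|.
Proof.
move=> xA xy; rewrite (cardsD1 x (nbr y)) nbr_sym // cardsU1.
by rewrite leq_add2r leq_b1.
Qed.

Lemma nbr2_sub x : nbr2 x \subset \bigcup_(y in nbr x) branch x y.
Proof.
apply/subsetP=> z /nbr2P[zx [xz|[y xy yz]]]; apply/bigcupP.
  by exists z => //; rewrite /branch setU11.
by exists y; rewrite // /branch in_setU in_setD1 zx yz orbT.
Qed.

Lemma card_bigcup_branch x (B : {set G}) : x \in A -> B \subset nbr x ->
  #|\bigcup_(y in B) branch x y| <= \sum_(y in B) #|nbr y|.
Proof.
move=> xA sB; apply: leq_trans (_ : \sum_(y in B) #|branch x y| <= _).
  elim/big_rec2: _ => [|y n C _ le_n]; first by rewrite cards0.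
  by rewrite (leq_trans (leq_card_setU _ _)) // leq_add2l.
by apply: leq_sum => y /(subsetP sB); apply: card_branch.
Qed.

Lemma card_nbr2 x : x \in A -> #|nbr2 x| <= \sum_(y in nbr x) #|nbr y|.
Proof.
move=> xA; apply: leq_trans (subset_leq_card (nbr2_sub x)) _.
exact: card_bigcup_branch.
Qed.

End Neighbourhoods.

(** * Erasing colours and recolouring greedily from lists of size 7 *)

Section Greedy.
Variables (G : sgraph) (C : eqType) (L : G -> seq C).
Hypothesis L7 : forall x, uniq (L x) /\ 7 <= size (L x).
Implicit Types (A : {set G}) (s : seq G).

(* A colouring of the square of G[A] from which the vertices of s have been
   erased; only their membership in L is retained. *)
Definition colorable_off A s : Prop :=
  exists2 c : G -> C, (forall x, c x \in L x) &
    forall x y, x \in A -> y \in A -> x \notin s -> y \notin s ->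
      y \in nbr2 A x -> c x != c y.

Lemma color_from_lists : exists c : G -> C, forall x, c x \in L x.
Proof.
have pick x : {a | a \in L x}.
  by have [_] := L7 x; case: (L x) => // a l _; exists a; rewrite mem_head.
by exists (fun x => sval (pick x)) => x; case: (pick x).
Qed.

(** A walk of length 2 through [v] joins two vertices of [nbr A v], all of them erased. So deleting
    [v] loses no conflict between vertices outside [s]. *)
Lemma colorable_off_delete A s v : colorable_off (A :\ v) [::] ->
  v \in s -> {subset nbr A v <= s} -> colorable_off A s.
Proof.
case=> c cL cP vs Ns; exists c => // x y xA yA xs ys xy.
have neq_v z : z \notin s -> z != v by apply: contraNneq => ->.
have in_del a b : a \notin s -> b \notin s -> b \in nbr A a -> b \in nbr (A :\ v) a.
  by move=> _ bs; rewrite !inE neq_v.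
apply: cP => //; [by rewrite in_setD1 neq_v | by rewrite in_setD1 neq_v |].
have [yx [adj_xy|[z xz zy]]] := nbr2P xy; first exact/nbr2_nbr/in_del.
have zv : z != v.
  by apply: contraNneq ys => zv; apply: Ns; rewrite -zv.
apply: (nbr2_path (y := z)) => //; first by move: xz; rewrite !inE zv.
by move: zy; rewrite !inE neq_v.
Qed.

(** The coloured square neighbours of [x] forbid at most 6 of its 7 colours. *)
Lemma colorable_off_cons A s x : x \in A ->
  #|nbr2 A x :\: [set z in s]| <= 6 ->
  colorable_off A (x :: s) -> colorable_off A s.
Proof.
move=> xA few [c cL cP]; set N := nbr2 A x :\: _ in few.
have /hasP[a aL aN] : has (fun a => a \notin map c (enum N)) (L x).
  have [uL szL] := L7 x; rewrite -[has _ _]negbK -all_predC; apply/negP => /allP sub.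
  have := leq_trans szL (uniq_leq_size uL (s2 := map c (enum N)) _).
  rewrite size_map -cardE leqNgt ltnS few => absurd.
  by apply/notF/absurd => b /sub /=; rewrite negbK.
exists (fun y => if y == x then a else c y) => [y|y z yA zA ys zs yz].
  by case: eqP => // ->.
have colored y' : y' \notin s -> y' \in nbr2 A x -> a != c y'.
  move=> ys' xy'; apply: contraNneq aN => ->; apply: map_f.
  by rewrite mem_enum in_setD inE ys'.
case: (eqVneq y x) => [yx|y_x]; case: (eqVneq z x) => [zx|z_x].
- by move: yz; rewrite yx zx in_setD1 eqxx.
- by apply: colored; rewrite -?yx.
- by rewrite eq_sym colored // -zx; apply: nbr2_sym.
- by apply: cP; rewrite // inE negb_or ?y_x ?z_x.
Qed.

(* The vertices of r are still uncoloured, so x sees at most 6 colours. *)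
Lemma colorable_off_greedy r A s x : x \in A -> uniq r ->
  all (mem s) r -> all (mem (nbr2 A x)) r ->
  #|nbr2 A x| <= 6 + size r ->
  colorable_off A (x :: s) -> colorable_off A s.
Proof.
move=> xA ur /allP rs /allP rN card2; apply: colorable_off_cons => //.
rewrite -(leq_add2r (size r)); apply: leq_trans card2.
rewrite -(cardsID [set z in s] (nbr2 A x)) addnC leq_add2r.
rewrite -(card_uniqP ur); apply/subset_leq_card/subsetP=> z zr.
by rewrite in_setI [_ \in nbr2 _ _]rN // inE; apply: rs.
Qed.

End Greedy.

(** * Reducible configurations in a minimal counterexample *)

Section Irreducible.
Variables (G : sgraph) (C : eqType) (L : G -> seq C) (A : {set G}).
Hypothesis L7 : forall x, uniq (L x) /\ 7 <= size (L x).
Hypothesis deg3 : forall x, #|nbr A x| <= 3.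
Hypothesis deletable : forall v, v \in A -> colorable_off L (A :\ v) [::].
Hypothesis irreducible : ~ colorable_off L A [::].

Definition small : {set G} := [set v in A | #|nbr A v| <= 2].

Lemma small_in v : v \in small -> v \in A.
Proof. by rewrite inE => /andP[]. Qed.

Lemma small_deg_le v : v \in small -> #|nbr A v| <= 2.
Proof. by rewrite inE => /andP[]. Qed.

Lemma sum_deg_le (B : {set G}) : \sum_(y in B) #|nbr A y| <= #|B| * 3.
Proof. by rewrite -sum_nat_const leq_sum. Qed.

Lemma card_nbr2_le9 x : x \in A -> #|nbr2 A x| <= 9.
Proof.
move=> xA; apply: leq_trans (card_nbr2 xA) (leq_trans (sum_deg_le _) _).
by rewrite (leq_mul2r 3 _ 3) deg3.
Qed.

Lemma card_nbr2_small v : v \in small -> #|nbr2 A v| <= 6.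
Proof.
move=> vS; apply: leq_trans (card_nbr2 (small_in vS)) (leq_trans (sum_deg_le _) _).
by rewrite (leq_mul2r 3 _ 2) small_deg_le.
Qed.

Lemma card_nbr2_nbr u v : u \in A -> v \in nbr A u ->
  #|nbr2 A u| <= #|nbr A v| + #|nbr A u :\ v| * 3.
Proof.
move=> uA uv; apply: leq_trans (card_nbr2 uA) _.
by rewrite (big_setD1 v) //= leq_add2l sum_deg_le.
Qed.

Lemma card_nbrD1 u v : v \in nbr A u -> #|nbr A u :\ v| = #|nbr A u|.-1.
Proof. by move=> uv; rewrite (cardsD1 v (nbr A u)) uv. Qed.

(** The count is 2 + 2 * 3, so [u] can be coloured while two of its square neighbours are
    uncoloured. *)
Lemma card_nbr2_nbr_small u v : u \in nbr A v -> v \in small -> #|nbr2 A u| <= 8.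
Proof.
move=> vu vS; have uv := nbr_sym (small_in vS) vu.
have := card_nbr2_nbr (nbr_in vu) uv; rewrite card_nbrD1 //.
by have := deg3 u; have := small_deg_le vS; lia.
Qed.

(** Otherwise colour the other neighbour [w] of [v], if any, while [u] and [v] are uncoloured, then
    [u] while [v] is uncoloured, then [v]. *)
Lemma nbr2_nbr_small u v : u \in nbr A v -> v \in small -> 7 < #|nbr2 A u|.
Proof.
move=> vu vS; rewrite ltnNge; apply/negP => card2; apply: irreducible.
have [vA uA] := (small_in vS, nbr_in vu); have uv := nbr_sym vA vu.
(* The argument runs backwards: the vertex treated first here is coloured last. *)
apply: (colorable_off_greedy L7 (r := [::]) vA) => //; first exact: card_nbr2_small.
apply: (colorable_off_greedy L7 (r := [:: v]) uA) => //.
- by rewrite /= nbr2_nbr.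
have [nv0|[w nvw]] : nbr A v :\ u = set0 \/ exists w, w \in nbr A v :\ u.
  by have [->|] := set_0Vmem (nbr A v :\ u); [left|case=> w; right; exists w].
- apply: (colorable_off_delete (v := v)); first exact: deletable.
    by rewrite !inE eqxx orbT.
  move=> z vz; rewrite inE; case: eqVneq => //= zu.
  by have := in_set0 z; rewrite -nv0 in_setD1 zu vz.
have [wu vw] := setD1P nvw.
apply: (colorable_off_greedy L7 (r := [:: u; v]) (nbr_in vw)) => //.
- by rewrite /= inE (nbr_neq vu).
- rewrite /= (nbr2_nbr (nbr_sym vA vw)) andbT.
  by rewrite (nbr2_path (nbr_sym vA vw) vu) // eq_sym.
- exact: card_nbr2_nbr_small vw vS.
apply: (colorable_off_delete (v := v)); first exact: deletable.
  by rewrite !inE eqxx !orbT.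
move=> z vz; rewrite !inE; case: (eqVneq z u) => [_|zu]; first by rewrite orbT.
have /card_le1_eqP le1 : #|nbr A v :\ u| <= 1.
  by rewrite card_nbrD1 //; have := small_deg_le vS; lia.
by rewrite (le1 z w) ?eqxx // in_setD1 zu.
Qed.

(** An isolated [v] could be coloured last. A neighbour [u] satisfies 8 <= [#|nbr2 A u|] <=
    [#|nbr A v|] + 2 * 3, which excludes degree 1. *)
Lemma small_deg v : v \in small -> #|nbr A v| = 2.
Proof.
move=> vS; have vA := small_in vS; have := small_deg_le vS.
case: (set_0Vmem (nbr A v)) => [nv0|[u vu]].
  case: irreducible; apply: (colorable_off_greedy L7 (r := [::]) vA) => //.
    exact: card_nbr2_small.
  apply: (colorable_off_delete (v := v)); rewrite ?inE ?eqxx //; first exact: deletable.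
  by move=> z; rewrite nv0 inE.
have := nbr2_nbr_small vu vS; have := card_nbr2_nbr (nbr_in vu) (nbr_sym vA vu).
by rewrite card_nbrD1 ?(nbr_sym vA) //; have := deg3 u; lia.
Qed.

Lemma small_nbrs v u : v \in small -> u \in nbr A v ->
  exists2 w, w != u & nbr A v = [set u; w].
Proof.
move=> vS vu; have /cards1P[w nw] : #|nbr A v :\ u| == 1.
  by rewrite card_nbrD1 // small_deg.
have /setD1P[wu vw] : w \in nbr A v :\ u by rewrite nw set11.
by exists w; rewrite // -(setD1K vu) nw.
Qed.

(** With [d] the degree of [u], 8 <= 2 + 3 * (d - 1) forces [d = 3]. *)
Lemma small_nbr_deg v u : v \in small -> u \in nbr A v -> #|nbr A u| = 3.
Proof.
move=> vS vu; have uv := nbr_sym (small_in vS) vu.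
have := nbr2_nbr_small vu vS; have := card_nbr2_nbr (nbr_in vu) uv.
by rewrite card_nbrD1 //; have := deg3 u; have := small_deg vS; lia.
Qed.

Lemma small_nbr_notin v u : v \in small -> u \in nbr A v -> u \notin small.
Proof. by move=> vS vu; rewrite inE (small_nbr_deg vS vu) andbF. Qed.

(** Two small neighbours would leave [u] at most 2 + 2 + 3 = 7 square neighbours. *)
Lemma small_nbr_unique u v v' : u \in A -> v \in nbr A u -> v' \in nbr A u ->
  v \in small -> v' \in small -> v = v'.
Proof.
move=> uA uv uv' vS v'S; apply/eqP; apply: contraT => vv'.
have vu := nbr_sym uA uv; have := nbr2_nbr_small vu vS.
rewrite ltnNge => /negP[]; apply: leq_trans (card_nbr2 uA) _.
have v'N : v' \in nbr A u :\ v by rewrite in_setD1 eq_sym vv'.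
rewrite (big_setD1 v) //= (big_setD1 v') //= !small_deg //.
have := sum_deg_le ((nbr A u :\ v) :\ v').
have := deg3 u; rewrite (cardsD1 v) uv (cardsD1 v') v'N; lia.
Qed.

(** This excludes triangles ([z = x]) and 4-cycles through [v]. On such a cycle the branch at [u]
    through [v] adds only [v] to the other branches, so [u] has at most 1 + 2 * 3 = 7 square
    neighbours. *)
Lemma small_no_short_cycle v u x z : v \in small -> u \in nbr A v ->
  x \in nbr A u -> x != v -> z \in nbr A v -> z != u -> z \notin branch A u x.
Proof.
move=> vS vu ux xv vz zu; apply/negP => zx.
have uA := nbr_in vu; have uv := nbr_sym (small_in vS) vu.
have := nbr2_nbr_small vu vS; rewrite ltnNge => /negP[].
pose B := nbr A u :\ v; pose U := \bigcup_(y in B) branch A u y.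
have sub : nbr2 A u \subset v |: U.
  apply: subset_trans (nbr2_sub A u) _; apply/bigcupsP=> y uy.
  have [-> | yv] := eqVneq y v; last first.
    apply: subset_trans (bigcup_sup y _) (subsetUr _ _) => //.
    by rewrite in_setD1 yv.
  rewrite /branch setUS //; apply/subsetP=> p /setD1P[pu vp].
  have [w _ nv] := small_nbrs vS vu.
  have -> : p = z.
    by move: vp vz; rewrite nv !inE (negPf pu) (negPf zu) => /eqP-> /eqP->.
  by apply/bigcupP; exists x => //; rewrite in_setD1 xv.
apply: leq_trans (subset_leq_card sub) _; rewrite cardsU1.
have le_U : #|U| <= \sum_(y in B) #|nbr A y| by apply/card_bigcup_branch/subsetDl.
have := sum_deg_le B; rewrite card_nbrD1 //; have := deg3 u.
have := leq_b1 (v \notin U); lia.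
Qed.

(* Colouring order w, w', u, u', v, v', where w, w' are the other neighbours of
   v, v'. *)
Lemma small_dist3 v u u' v' : v \in small -> v' \in small ->
  u \in nbr A v -> u' \in nbr A u -> v' \in nbr A u' -> v = v'.
Proof.
move=> vS v'S vu uu' u'v'; apply/eqP; apply: contraT => vv'; case: irreducible.
have [vA v'A uA u'A] := And4 (small_in vS) (small_in v'S) (nbr_in vu) (nbr_in uu').
have [uv u'u v'u'] := And3 (nbr_sym vA vu) (nbr_sym uA uu') (nbr_sym u'A u'v').
have [w wu nv] := small_nbrs vS vu.
have [w' w'u' nv'] := small_nbrs v'S v'u'.
have vw : w \in nbr A v by rewrite nv !inE eqxx orbT.
have v'w' : w' \in nbr A v' by rewrite nv' !inE eqxx orbT.
have vu' : v != u' by apply: contraNneq (small_nbr_notin v'S v'u') => <-.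
have v'u : v' != u by apply: contraNneq (small_nbr_notin vS vu) => <-.
(* The erased list [s] may repeat a vertex, so coincidences such as [w = w'] need no case split. *)
have go r x s := @colorable_off_greedy _ _ _ L7 r A s x.
apply: (go [::] v') => //; first exact: card_nbr2_small.
apply: (go [::] v) => //; first exact: card_nbr2_small.
apply: (go [:: v; v'] u') => //.
- by rewrite /= inE vv'.
- by rewrite /= (nbr2_path u'u uv) // nbr2_nbr.
- exact: card_nbr2_nbr_small v'u' v'S.
apply: (go [:: v; v'] u) => //.
- by rewrite /= inE vv'.
- by rewrite /= !inE !eqxx !orbT.
- by rewrite /= (nbr2_path uu' u'v') // nbr2_nbr.
- exact: card_nbr2_nbr_small vu vS.
apply: (go [:: v'; u'] w').
- exact: nbr_in v'w'.
- by rewrite /= inE eq_sym (nbr_neq v'u').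
- by rewrite /= !inE !eqxx !orbT.
- rewrite /= nbr2_nbr ?(nbr_sym v'A) //.
  by rewrite (nbr2_path (nbr_sym v'A v'w') v'u') // eq_sym.
- exact: card_nbr2_nbr_small v'w' v'S.
apply: (go [:: v; u] w).
- exact: nbr_in vw.
- by rewrite /= inE eq_sym (nbr_neq vu).
- by rewrite /= !inE !eqxx !orbT.
- rewrite /= nbr2_nbr ?(nbr_sym vA) //.
  by rewrite (nbr2_path (nbr_sym vA vw) vu) // eq_sym.
- exact: card_nbr2_nbr_small vw vS.
apply: (colorable_off_delete (v := v)); first exact: deletable.
  by rewrite !inE eqxx !orbT.
by move=> z; rewrite nv !inE => /orP[] /eqP->; rewrite eqxx ?orbT.
Qed.

(* Colouring order w1, w2, w3, y1, y2, y3, x, v1, v2, v3, where wi is the other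
   neighbour of the small vertex vi next to yi. *)
Lemma far_from_some_small x : x \in A -> x \notin small ->
  exists2 y, y \in nbr A x & nbr A y :&: small = set0.
Proof.
move=> xA xS.
suff /exists_inP[y xy /eqP ny] : [exists y in nbr A x, nbr A y :&: small == set0].
  by exists y.
apply: contraT; rewrite negb_exists => /forallP H; case: irreducible.
have near y : y \in nbr A x -> exists v w, [/\ v \in small, y \in nbr A v,
    w != y & nbr A v = [set y; w]].
  move=> xy; have := H y; rewrite xy /= => /set0Pn[v /setIP[yv vS]].
  have vy := nbr_sym (nbr_in xy) yv.
  by have [w wy nv] := small_nbrs vS vy; exists v, w.
have degx : 2 < #|nbr A x| by move: xS; rewrite inE xA ltnNge.
have /card_gt2P[y1 [y2 [y3 [[xy1 xy2 xy3] [y12 y23 y31]]]]] := degx.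
have [v1 [w1 [v1S v1y wy1 nv1]]] := near _ xy1.
have [v2 [w2 [v2S v2y wy2 nv2]]] := near _ xy2.
have [v3 [w3 [v3S v3y wy3 nv3]]] := near _ xy3.
have vx v : v \in small -> v != x by move=> vS; apply: contraNneq xS => <-.
(* A small vertex common to [y] and [y'] would close a 4-cycle with [x]. *)
have neq_v v v' y y' : v \in small -> y \in nbr A x -> y' \in nbr A x ->
    y \in nbr A v -> y' \in nbr A v' -> y != y' -> v != v'.
  move=> vS xy xy' vy v'y' yy'; apply/eqP => vv'; rewrite -vv' in v'y'.
  have := small_no_short_cycle vS vy (nbr_sym xA xy) _ v'y'.
  rewrite eq_sym vx // eq_sym yy' => /(_ isT isT)/negP[].
  by rewrite /branch in_setU in_setD1 eq_sym yy' xy' orbT.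
have v12 : v1 != v2 by apply: neq_v v1y v2y y12.
have v23 : v2 != v3 by apply: neq_v v2y v3y y23.
have v13 : v1 != v3 by apply: neq_v v1y v3y _; rewrite 1?eq_sym.
have go r z s := @colorable_off_greedy _ _ _ L7 r A s z.
have go_v s v : v \in small -> colorable_off L A (v :: s) -> colorable_off L A s.
  by move=> vS; apply: (go [::]) => //; [apply: small_in | apply: card_nbr2_small].
have go_y s y v : v \in small -> y \in nbr A v -> y \in nbr A x ->
    x \in s -> v \in s -> colorable_off L A (y :: s) -> colorable_off L A s.
  move=> vS vy xy xs vs; have yv := nbr_sym (small_in vS) vy.
  apply: (go [:: x; v]); first exact: nbr_in xy.
  - by rewrite /= inE eq_sym vx.
  - by rewrite /= xs vs.
  - by rewrite /= !nbr2_nbr // nbr_sym.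
  - exact: card_nbr2_nbr_small vy vS.
have go_w s y v w : v \in small -> y \in nbr A v -> w \in nbr A v -> w != y ->
    y \in s -> v \in s -> colorable_off L A (w :: s) -> colorable_off L A s.
  move=> vS vy vw wy ys vs; have wv := nbr_sym (small_in vS) vw.
  apply: (go [:: y; v]); first exact: nbr_in vw.
  - by rewrite /= inE (nbr_neq vy).
  - by rewrite /= ys vs.
  - by rewrite /= (nbr2_nbr wv) (nbr2_path wv vy) // eq_sym.
  - exact: card_nbr2_nbr_small vw vS.
apply: (go_v _ v3) => //; apply: (go_v _ v2) => //; apply: (go_v _ v1) => //.
(* Here 9 = 6 + 3: [x] is coloured while the three distinct [vi] are uncoloured. *)
apply: (go [:: v1; v2; v3] x) => //.
- by rewrite /= !inE negb_or v12 v13 v23.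
- have N2 y v : v \in small -> y \in nbr A x -> y \in nbr A v -> v \in nbr2 A x.
    by move=> vS xy vy; rewrite (nbr2_path xy) ?vx // nbr_sym // small_in.
  by rewrite /= (N2 y1) // (N2 y2) // (N2 y3).
- exact: card_nbr2_le9.
apply: (go_y _ y3 v3) => //; rewrite ?inE ?eqxx ?orbT //.
apply: (go_y _ y2 v2) => //; rewrite ?inE ?eqxx ?orbT //.
apply: (go_y _ y1 v1) => //; rewrite ?inE ?eqxx ?orbT //.
apply: (go_w _ y3 v3 w3) => //; rewrite ?nv3 ?inE ?eqxx ?orbT //.
apply: (go_w _ y2 v2 w2) => //; rewrite ?nv2 ?inE ?eqxx ?orbT //.
apply: (go_w _ y1 v1 w1) => //; rewrite ?nv1 ?inE ?eqxx ?orbT //.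
apply: (colorable_off_delete (v := v1)); first exact/deletable/small_in.
  by rewrite !inE eqxx !orbT.
by move=> z; rewrite nv1 !inE => /orP[] /eqP->; rewrite eqxx ?orbT.
Qed.

(** * Discharging: weights sent by small vertices *)

Definition small_nbr x := \sum_(y in nbr A x) (y \in small).

Lemma sum_nbr (F : G -> nat) :
  \sum_(x in A) \sum_(y in nbr A x) F y = \sum_(y in A) #|nbr A y| * F y.
Proof.
rewrite (exchange_big_dep (mem A)) /=; last by move=> x y _; apply: nbr_in.
apply: eq_bigr => y yA; rewrite -sum_nat_const; apply: eq_bigl => x.
by rewrite !inE adj_sym yA.
Qed.

Lemma small_nbrE x : small_nbr x = #|nbr A x :&: small|.
Proof.
rewrite -sum1_card (eq_bigl _ _ (fun y => in_setI y _ _)) big_mkcondr /=.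
by apply: eq_bigr => y _; case: (y \in small).
Qed.

Lemma small_nbr_le1 x : x \in A -> small_nbr x <= 1.
Proof.
move=> xA; rewrite small_nbrE; apply/card_le1_eqP => v v' /setIP[xv vS] /setIP[xv' v'S].
exact: small_nbr_unique xA xv' xv v'S vS.
Qed.

Lemma small_nbr_small x : x \in small -> small_nbr x = 0.
Proof.
by move=> xS; apply: big1 => y xy; rewrite (negPf (small_nbr_notin xS xy)).
Qed.

(** A small [x] gets at most 1 through each of its two neighbours. If [x] has a small neighbour [v],
    it gets 2 from it and nothing else: a small vertex next to a neighbour [y] of [x] other than [v]
    would be [v] itself, by [small_dist3], and close a triangle. Otherwise one neighbour of [x]
    transmits nothing and at most two others transmit 1 each. *)
Lemma weight_le2 x : x \in A ->
  2 * small_nbr x + \sum_(y in nbr A x) small_nbr y <= 2.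
Proof.
move=> xA; have le_b (B : {set G}) : B \subset nbr A x -> \sum_(y in B) small_nbr y <= #|B|.
  move=> /subsetP sB; rewrite -sum1_card; apply: leq_sum => y /sB xy.
  exact: small_nbr_le1 (nbr_in xy).
have [xS|xS] := boolP (x \in small).
  by rewrite small_nbr_small // (leq_trans (le_b _ _)) // small_deg_le.
have := small_nbr_le1 xA; rewrite leq_eqVlt ltnS leqn0 => /orP[/eqP a1|/eqP a0].
  rewrite a1 big1 // => y xy.
  move/eqP: a1; rewrite small_nbrE => /cards1P[v nv].
  have /setIP[xv vS] : v \in nbr A x :&: small by rewrite nv set11.
  have [yS|yS] := boolP (y \in small); first exact: small_nbr_small.
  rewrite small_nbrE; apply/eqP; rewrite cards_eq0; apply/set0Pn => -[v' /setIP[yv' v'S]].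
  have vx := nbr_sym xA xv.
  have vv' := small_dist3 vS v'S vx xy yv'; rewrite -vv' in yv'.
  have yv : y != v by apply: contraNneq yS => ->.
  have := small_no_short_cycle vS vx xy yv (nbr_sym (nbr_in xy) yv') (nbr_neq xy).
  by rewrite /branch setU11.
have [y xy ny] := far_from_some_small xA xS.
rewrite a0 (big_setD1 y) //= small_nbrE ny cards0.
rewrite (leq_trans (le_b _ (subsetDl _ _))) // card_nbrD1 //.
by have := deg3 x; lia.
Qed.

(** Each small vertex sends 2 * 2 directly and 2 * 3 along walks, as its two neighbours have degree
    3. Hence 10 * [#|small|] <= 2 * [#|A|]. *)
Lemma card_small : 5 * #|small| <= #|A|.
Proof.
have sum_a : \sum_(x in A) small_nbr x = 2 * #|small|.
  rewrite sum_nbr -sum1_card big_distrr /= (big_setID small) /=.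
  rewrite [X in _ + X]big1 => [|y /setDP[_ /negPf->]]; last by rewrite muln0.
  rewrite addn0; apply: eq_big => [v|v /setIP[_ vS]]; last by rewrite vS small_deg.
  by rewrite inE andb_idl // => /small_in.
have sum_b : \sum_(x in A) \sum_(y in nbr A x) small_nbr y = 3 * (2 * #|small|).
  rewrite sum_nbr -sum_a big_distrr /=; apply: eq_bigr => y yA.
  have [->|a_gt0] := posnP (small_nbr y); first by rewrite !muln0.
  move: a_gt0; rewrite {1}small_nbrE => /card_gt0P[v /setIP[yv vS]].
  by rewrite (small_nbr_deg vS (nbr_sym yA yv)).
have : \sum_(x in A) (2 * small_nbr x + \sum_(y in nbr A x) small_nbr y)
       <= \sum_(x in A) 2 by apply: leq_sum => x; apply: weight_le2.
by rewrite big_split /= -big_distrr /= sum_a sum_b sum_nat_const; lia.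
Qed.

Lemma sum_deg_ge : 14 * #|A| <= 5 * \sum_(x in A) #|nbr A x|.
Proof.
have : \sum_(x in A) 3 <= \sum_(x in A) (#|nbr A x| + (x \in small)).
  apply: leq_sum => x xA; have [xS|] := boolP (x \in small).
    by rewrite small_deg.
  by rewrite inE xA ltnNge => /=; rewrite addn0.
rewrite sum_nat_const big_split /=.
have -> : \sum_(x in A) (x \in small) = #|small|.
  rewrite -sum1_card [RHS](eq_bigl (fun x => (x \in A) && (x \in small))).
    by rewrite big_mkcondr; apply: eq_bigr => x _; case: (x \in small).
  by move=> x; rewrite andb_idl // => /small_in.
by have := card_small; lia.
Qed.

End Irreducible.

(** * Induction on the vertex set, and passage from [mad] and [dist] to neighbourhoods *)

Lemma colorable_sparse (G : sgraph) (C : eqType) (L : G -> seq C) :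
  (forall x, uniq (L x) /\ 7 <= size (L x)) -> (forall x : G, degree x <= 3) ->
  (forall S : {set G}, S != set0 -> 5 * (\sum_(x in S) #|nbr S x|) < 14 * #|S|) ->
  forall A, colorable_off L A [::].
Proof.
move=> L7 deg3 sparse A; have [n] := ubnP #|A|; elim: n A => // n IHn A.
rewrite ltnS => leAn; apply: contrapT => irr.
have [A0|A0] := eqVneq A set0.
  by apply: irr; have [c cL] := color_from_lists L7; exists c => // x y; rewrite A0 inE.
have deg3A x : #|nbr A x| <= 3.
  by apply: leq_trans (deg3 x); apply/subset_leq_card/subsetP=> y; rewrite !inE => /andP[].
have del v : v \in A -> colorable_off L (A :\ v) [::].
  by move=> vA; apply: IHn; move: leAn; rewrite (cardsD1 v) vA.
by have := sparse A A0; rewrite ltnNge (sum_deg_ge L7 deg3A del irr).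
Qed.

(** Ordered adjacent pairs are grouped by the edge they span; at most two pairs span the same
    edge. *)
Lemma sum_degree (G : sgraph) : \sum_(x : G) degree x <= 2 * #|edges G|.
Proof.
rewrite (eq_bigr (fun x => \sum_(y | adj x y) 1)); last first.
  by move=> x _; rewrite sum1_card /degree; apply: eq_card => y; rewrite inE.
rewrite pair_big_dep /= (partition_big (fun p : G * G => [set p.1; p.2]) (mem (edges G))) /=.
  rewrite mulnC -sum_nat_const; apply: leq_sum => E /imsetP[[x y] _ ->] /=.
  rewrite sum1_card.
  apply: leq_trans (_ : #|[set (x, y); (y, x)]| <= 2); last first.
    by rewrite cards2; case: (_ != _).
  apply/subset_leq_card/subsetP=> -[a b]; rewrite !inE /= => /andP[ab /eqP eqE].
  have aE : a \in [set x; y] by rewrite -eqE set21.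
  have bE : b \in [set x; y] by rewrite -eqE set22.
  have ne : a != b by apply: contraTneq ab => ->; rewrite adj_irrefl.
  rewrite !xpair_eqE; move: aE bE ne; rewrite !inE.
  by do 2![case/orP=> /eqP->]; rewrite !eqxx ?orbT.
by move=> p xy; apply: imset_f; rewrite inE.
Qed.

Lemma degree_induced (G : sgraph) (S : {set G}) (x : induced S) :
  degree x = #|nbr S (val x)|.
Proof.
rewrite /degree -(card_imset _ val_inj); apply: eq_card => y.
apply/imsetP/idP=> [[z]|]; first by rewrite !inE => xz ->; rewrite (valP z).
rewrite inE => /andP[yS xy]; exists (Sub y yS : induced S) => //.
by rewrite inE.
Qed.

Lemma sparse_mad (G : sgraph) (S : {set G}) : (mad G < 14 / 5)%R -> S != set0 ->
  5 * (\sum_(x in S) #|nbr S x|) < 14 * #|S|.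
Proof.
move=> madG S0.
have : (average_degree (induced S) <= mad G)%R.
  exact: Order.TotalTheory.le_bigmax_cond.
move=> /Order.POrderTheory.le_lt_trans/(_ madG).
have cS : #|induced S| = #|S| by rewrite card_sig; apply: eq_card => x.
rewrite /average_degree cS.
have S_gt0 : 0 < #|S| by rewrite card_gt0.
rewrite Num.Theory.ltr_pdivrMr ?Num.Theory.ltr0n //.
have := sum_degree (induced S).
have -> : \sum_(x : induced S) degree x = \sum_(x in S) #|nbr S x|.
  rewrite (eq_bigr _ (fun x _ => degree_induced x)).
  by rewrite (big_sub S (fun x => #|nbr S x|)).
rewrite GRing.mulrAC Num.Theory.ltr_pdivlMr // -!GRing.natrM Num.Theory.ltr_nat.
lia.
Qed.

(** A duplicate-free path from [x] to [y] has length below [#|G|], so the search in [dist] succeeds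
    and its value is the length of an actual walk, here 1 or 2. *)
Lemma square_adj_nbr2 (G : sgraph) (x y : G) : square_adj x y -> y \in nbr2 setT x.
Proof.
case/and3P=> xy /connectP[p0 pth0 y_last].
case/shortenP: pth0 y_last => p pth upn _ y_last dist2.
have lt_p : size p < #|G| by rewrite -[_.+1](card_uniqP upn) max_card.
have has_walk : has (fun n => walk n x y) (iota 0 #|G|).
  apply/hasP; exists (size p); first by rewrite mem_iota.
  by apply/existsP; exists (in_tuple p); rewrite pth y_last eqxx.
have := nth_find 0 has_walk; rewrite has_find size_iota in has_walk.
rewrite nth_iota // add0n -/(dist x y).
move: (dist x y) dist2 => [|[|[|//]]] _ /existsP[[q q_sz]] /=.
- by rewrite (size0nil (eqP q_sz)) (negPf xy).
- case: q q_sz => [|a [|? ?]] //= _ /andP[/andP[xa _] /eqP <-].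
  by apply: nbr2_nbr; rewrite !inE.
case: q q_sz => [|a [|b [|? ?]]] //= _ /andP[/and3P[xa ab _] /eqP b_y].
rewrite b_y in ab; apply: (nbr2_path (y := a)); rewrite ?inE //.
by rewrite eq_sym.
Qed.

Theorem theorem14 (G : sgraph) :
  max_degree G <= 3 ->
  (mad G < 14 / 5)%R ->
  list_chromatic_number (square G) <= 7.
Proof.
move=> degG madG; rewrite /list_chromatic_number; case: ex_minnP => k _; apply.
apply/asboolP => C L L7.
have deg3 (x : G) : degree x <= 3.
  by apply: leq_trans degG; rewrite /max_degree (leq_bigmax x).
have [c cL cP] := @colorable_sparse G C L L7 deg3 (fun S => sparse_mad madG) setT.
by exists c => // x y /square_adj_nbr2; apply: cP; rewrite ?inE.
Qed.
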